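(* Let $J\colon\mathcal S_n\to\mathbb R$ be strictly isotone and let Assumption (A1) hold. Then problem (OF) and problem (SDP) are equivalent in the following sense: $(\boldsymbol K_1^\ast,\boldsymbol K_2^\ast,\hat{\boldsymbol P}^\ast)\in\mathcal F_H$ is a solution of problem (OF) if and only if there exists $\boldsymbol\alpha^\ast\colon\mathcal D_F\to\mathbb R$ such that $(\boldsymbol\alpha^\ast,\boldsymbol K_1^\ast,\boldsymbol K_2^\ast,\hat{\boldsymbol P}^\ast)$ is a solution of problem (SDP).
   Context: $n,p_1,p_2$ are positive integers, $p_1,p_2\le n$, $H_1\in\mathbb R^{p_1\times n}$, $H_2\in\mathbb R^{p_2\times n}$, $H=\begin{pmatrix}H_1\\H_2\end{pmatrix}$. Assumption (A1): $\mathrm{rk}(H_1)=p_1$, $\mathrm{rk}(H_2)=p_2$, $\mathrm{rk}(H)=n$ (and the two input estimators $\hat x_1,\hat x_2$ are unbiased estimators of $H_1x_{\rm true}$, $H_2x_{\rm true}$; in the deterministic maps below only their values enter). $\mathcal S_m,\mathcal P_m,\mathcal P_m^\succ$: real symmetric, positive semi-definite, positive definite $m\times m$ matrices; $\preceq$ is the Löwner order; $M^{1/2}$ is the positive semi-definite square root. $\mathcal D_F:=\mathbb R^{p_1}\times\mathbb R^{p_2}\times\mathcal P_{p_1}^\succ\times\mathcal P_{p_2}^\succ$, with points denoted $(\hat x_1,\hat x_2,\hat P_1,\hat P_2)$. All statements about maps on $\mathcal D_F$ are read pointwise on $\mathcal D_F$. $J$ is strictly isotone if $A\preceq B$ implies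 $J(A)\le J(B)$ and ($A\preceq B$, $A\ne B$) implies $J(A)<J(B)$, for all $A,B\in\mathcal S_n$. $\mathcal F_H$ is the set of maps (linear fusion rules) $(\boldsymbol K_1,\boldsymbol K_2,\hat{\boldsymbol P})\colon\mathcal D_F\to\mathbb R^{n\times p_1}\times\mathbb R^{n\times p_2}\times\mathcal P_n^\succ$ that are unbiased, i.e. $\boldsymbol K_1H_1+\boldsymbol K_2H_2=I$ on $\mathcal D_F$, and preserve conservativeness on $\mathcal P_{p_1+p_2}^\succ$, i.e. for all $(\hat x_1,\hat x_2,\hat P_1,\hat P_2)\in\mathcal D_F$ and all $P_{\rm joint}=\begin{pmatrix}P_1&P_{12}\\P_{12}^\top&P_2\end{pmatrix}\in\mathcal P_{p_1+p_2}^\succ$ with $P_1\preceq\hat P_1$ and $P_2\preceq\hat P_2$ one has $\begin{pmatrix}\boldsymbol K_1&\boldsymbol K_2\end{pmatrix}P_{\rm joint}\begin{pmatrix}\boldsymbol K_1&\boldsymbol K_2\end{pmatrix}^\top\preceq\hat{\boldsymbol P}$. Problem (OF): a solution is an element $(\boldsymbol K_1^\ast,\boldsymbol K_2^\ast,\hat{\boldsymbol P}^\ast)\in\mathcal F_H$ with $J(\hat{\boldsymbol P}^\ast)\le J(\hat{\boldsymbol P})$ at every point of $\mathcal D_F$ for every $(\boldsymbol K_1,\boldsymbol K_2,\hat{\boldsymbol P})\in\mathcal F_H$. Problem (SDP): pointwise at each $(\hat x_1,\hat x_2,\hat P_1,\hat P_2)\in\mathcal D_F$, minimize $J(\hat{\boldsymbol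 P})$ over $(\boldsymbol\alpha,\boldsymbol K_1,\boldsymbol K_2,\hat{\boldsymbol P})\in\mathbb R\times\mathbb R^{n\times p_1}\times\mathbb R^{n\times p_2}\times\mathcal P_n$ subject to $$\begin{pmatrix}\hat{\boldsymbol P}&\boldsymbol K_1\hat P_1^{1/2}&\boldsymbol K_2\hat P_2^{1/2}\\ \hat P_1^{1/2}\boldsymbol K_1^\top&\boldsymbol\alpha I&0\\ \hat P_2^{1/2}\boldsymbol K_2^\top&0&(1-\boldsymbol\alpha)I\end{pmatrix}\succeq0,\qquad \boldsymbol K_1H_1+\boldsymbol K_2H_2=I.$$ A solution is a map on $\mathcal D_F$ whose value at each point is feasible and minimizes $J(\hat{\boldsymbol P})$ among all feasible values at that point. *)

(* Defs.v *)
From mathcomp Require Import all_boot all_order all_algebra sesquilinear.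
From mathcomp Require Import boolp classical_sets reals.

Set Implicit Arguments.
Unset Strict Implicit.
Unset Printing Implicit Defensive.

Import Order.TTheory GRing.Theory Num.Theory.
Local Open Scope ring_scope.

Definition possemidef (R : realType) (m : nat) (A : 'M[R]_m) : Prop :=
  A \is symmetricmx /\ forall x : 'cV[R]_m, 0 <= (x^T *m A *m x) 0 0.

Definition posdef (R : realType) (m : nat) (A : 'M[R]_m) : Prop :=
  A \is symmetricmx /\
  forall x : 'cV[R]_m, x != 0 -> 0 < (x^T *m A *m x) 0 0.

Definition loewner_le (R : realType) (m : nat) (A B : 'M[R]_m) : Prop :=
  possemidef (B - A).

Notation "A <=L B" := (loewner_le A B) (at level 70, no associativity).

(* For positive semi-definite A the set below is a singleton, so this is the
   positive semi-definite square root; the default 0 is only returned for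
   other A. *)
Definition sqrtmx (R : realType) (m : nat) (A : 'M[R]_m) : 'M[R]_m :=
  xget 0 [set S : 'M[R]_m | possemidef S /\ S *m S = A]%classic.

(* J represents a function on symmetric matrices only: its values elsewhere are
   unconstrained, and are not used anywhere below. *)
Definition strictly_isotone (R : realType) (n : nat) (J : 'M[R]_n -> R) : Prop :=
  forall A B : 'M[R]_n, A \is symmetricmx -> B \is symmetricmx -> A <=L B ->
    J A <= J B /\ (A != B -> J A < J B).

(* The domain R^p1 x R^p2 x {positive definite} x {positive definite}. *)
Record fusion_input (R : realType) (p1 p2 : nat) := FusionInput {
  est1 : 'cV[R]_p1;
  est2 : 'cV[R]_p2;
  cov1 : 'M[R]_p1;
  cov2 : 'M[R]_p2;
  cov1_posdef : posdef cov1;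
  cov2_posdef : posdef cov2
}.

Definition unbiased_gains (R : realType) (n p1 p2 : nat)
    (H1 : 'M[R]_(p1, n)) (H2 : 'M[R]_(p2, n))
    (K1 : 'M[R]_(n, p1)) (K2 : 'M[R]_(n, p2)) : Prop :=
  K1 *m H1 + K2 *m H2 = 1%:M.

Definition preserves_conservativeness (R : realType) (n p1 p2 : nat)
    (K1 : fusion_input R p1 p2 -> 'M[R]_(n, p1))
    (K2 : fusion_input R p1 p2 -> 'M[R]_(n, p2))
    (P : fusion_input R p1 p2 -> 'M[R]_n) : Prop :=
  forall (z : fusion_input R p1 p2)
         (P1 : 'M[R]_p1) (P12 : 'M[R]_(p1, p2)) (P2 : 'M[R]_p2),
    let Pjoint := block_mx P1 P12 P12^T P2 in
    let K := row_mx (K1 z) (K2 z) in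
    posdef Pjoint -> P1 <=L cov1 z -> P2 <=L cov2 z ->
    K *m Pjoint *m K^T <=L P z.

(* Membership in the set F_H of linear fusion rules. *)
Definition fusion_rule (R : realType) (n p1 p2 : nat)
    (H1 : 'M[R]_(p1, n)) (H2 : 'M[R]_(p2, n))
    (K1 : fusion_input R p1 p2 -> 'M[R]_(n, p1))
    (K2 : fusion_input R p1 p2 -> 'M[R]_(n, p2))
    (P : fusion_input R p1 p2 -> 'M[R]_n) : Prop :=
  [/\ forall z, posdef (P z),
      forall z, unbiased_gains H1 H2 (K1 z) (K2 z)
    & preserves_conservativeness K1 K2 P].

Definition OF_solution (R : realType) (n p1 p2 : nat)
    (H1 : 'M[R]_(p1, n)) (H2 : 'M[R]_(p2, n)) (J : 'M[R]_n -> R)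
    (K1 : fusion_input R p1 p2 -> 'M[R]_(n, p1))
    (K2 : fusion_input R p1 p2 -> 'M[R]_(n, p2))
    (P : fusion_input R p1 p2 -> 'M[R]_n) : Prop :=
  fusion_rule H1 H2 K1 K2 P /\
  forall (L1 : fusion_input R p1 p2 -> 'M[R]_(n, p1))
         (L2 : fusion_input R p1 p2 -> 'M[R]_(n, p2))
         (Q : fusion_input R p1 p2 -> 'M[R]_n),
    fusion_rule H1 H2 L1 L2 Q -> forall z, J (P z) <= J (Q z).

Definition SDP_matrix (R : realType) (n p1 p2 : nat) (z : fusion_input R p1 p2)
    (a : R) (K1 : 'M[R]_(n, p1)) (K2 : 'M[R]_(n, p2)) (P : 'M[R]_n) :
    'M[R]_(n + (p1 + p2)) :=
  let S1 := sqrtmx (cov1 z) in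
  let S2 := sqrtmx (cov2 z) in
  block_mx P (row_mx (K1 *m S1) (K2 *m S2))
           (col_mx (S1 *m K1^T) (S2 *m K2^T))
           (block_mx a%:M 0 0 (1 - a)%:M).

Definition SDP_feasible (R : realType) (n p1 p2 : nat)
    (H1 : 'M[R]_(p1, n)) (H2 : 'M[R]_(p2, n)) (z : fusion_input R p1 p2)
    (a : R) (K1 : 'M[R]_(n, p1)) (K2 : 'M[R]_(n, p2)) (P : 'M[R]_n) : Prop :=
  [/\ possemidef P, possemidef (SDP_matrix z a K1 K2 P)
    & unbiased_gains H1 H2 K1 K2].

Definition SDP_solution (R : realType) (n p1 p2 : nat)
    (H1 : 'M[R]_(p1, n)) (H2 : 'M[R]_(p2, n)) (J : 'M[R]_n -> R)
    (a : fusion_input R p1 p2 -> R)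
    (K1 : fusion_input R p1 p2 -> 'M[R]_(n, p1))
    (K2 : fusion_input R p1 p2 -> 'M[R]_(n, p2))
    (P : fusion_input R p1 p2 -> 'M[R]_n) : Prop :=
  forall z : fusion_input R p1 p2,
    SDP_feasible H1 H2 z (a z) (K1 z) (K2 z) (P z) /\
    forall (b : R) (L1 : 'M[R]_(n, p1)) (L2 : 'M[R]_(n, p2)) (Q : 'M[R]_n),
      SDP_feasible H1 H2 z b L1 L2 Q -> J (P z) <= J Q.

(* Main.v *)
Require Import Defs.
From mathcomp Require Import all_boot all_order all_algebra.
From mathcomp Require Import spectral sesquilinear boolp classical_sets reals.
From mathcomp Require Import complex ring lra.

(** Both problems minimize the same objective over the same set. Fix a point
    z of the domain, with covariance bounds C1 and C2 and their square roots
    S1 and S2. The claim behind the theorem is that (K1, K2, P) is an unbiased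
    conservative rule at z if and only if it is feasible for the semidefinite
    program with some parameter a ([fusion_rule_SDP]). The constraints of a
    fusion rule at different points do not interact, so a feasible
    competitor at one point extends to a global rule, by following the given
    rule at the other points; hence pointwise and global optimality coincide.

    Evaluated at (x, u, v), the quadratic form of the SDP matrix is
      x'Px + 2 (S1 K1'x)'u + 2 (S2 K2'x)'v + a |u|^2 + (1 - a) |v|^2.

    Feasible implies conservative ([SDP_conservative]). Necessarily
    0 <= a <= 1. For 0 < a < 1, the choice u = - S1 K1'x / a,
    v = - S2 K2'x / (1 - a) gives c1 / a + c2 / (1 - a) <= x'Px, where
    ci = (Ki'x)' Ci (Ki'x); and positivity of a joint covariance with diagonal
    blocks below C1 and C2, tested on the vector ((1 - a) K1'x, - a K2'x),
    bounds its value at (K1'x, K2'x) by the left-hand side. The end points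
    a = 0 and a = 1 force c1 = 0, respectively c2 = 0.

    Conservative implies feasible ([conservative_SDP]). This is where a single
    a must be found for all x, and it is an instance of the S-lemma
    ([s_lemma]): the form above is q0 - a q1, where q1 = |v|^2 - |u|^2 and q0 is
    its value for a = 0, so it suffices that q0 >= 0 on the cone |u| = |v|.
    On this cone, u and v determine a worst cross-covariance, proportional to
    S1 u v' S2, and conservativeness for it (approached from the positive
    definite side) bounds x'Px from below by a quantity that completes
    q0 to a square.

    The S-lemma is obtained by taking for a the supremum of q0 / q1
    over q1 < 0; the two-sided comparison needed comes from evaluating q0 at
    the two zeros of q1 on a line. The existence of the square roots S1 and S2
    comes from the spectral theorem over the complex numbers, pulled back to
    the reals by a real interpolation polynomial. *)

Set Implicit Arguments.
Unset Strict Implicit.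
Unset Printing Implicit Defensive.

Import Order.TTheory GRing.Theory Num.Theory.
Local Open Scope ring_scope.

(** * Dot products and quadratic forms *)

Lemma symmetricmxP (R : realType) m (A : 'M[R]_m) :
  A \is symmetricmx <-> A^T = A.
Proof.
split=> [/is_hermitianmxP|tA].
  by rewrite expr0 scale1r map_mx_id // => <-.
by apply/is_hermitianmxP; rewrite expr0 scale1r map_mx_id ?tA.
Qed.

Section Dot.
Variable R : realType.

Definition dot m (u v : 'cV[R]_m) : R := (u^T *m v) 0 0.

Lemma dotC m (u v : 'cV[R]_m) : dot u v = dot v u.
Proof. by rewrite /dot -[in LHS](trmxK v) -trmx_mul mxE. Qed.

Lemma dotDr m (u v w : 'cV[R]_m) : dot u (v + w) = dot u v + dot u w.
Proof. by rewrite /dot mulmxDr mxE. Qed.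

Lemma dotDl m (u v w : 'cV[R]_m) : dot (v + w) u = dot v u + dot w u.
Proof. by rewrite dotC dotDr !(dotC u). Qed.

Lemma dotZr m (u v : 'cV[R]_m) a : dot u (a *: v) = a * dot u v.
Proof. by rewrite /dot -scalemxAr mxE. Qed.

Lemma dotZl m (u v : 'cV[R]_m) a : dot (a *: v) u = a * dot v u.
Proof. by rewrite dotC dotZr dotC. Qed.

Lemma dot0r m (u : 'cV[R]_m) : dot u 0 = 0.
Proof. by rewrite /dot mulmx0 mxE. Qed.

Lemma dot_mulmxr m k (u : 'cV[R]_m) (A : 'M[R]_(m, k)) v :
  dot u (A *m v) = dot (A^T *m u) v.
Proof. by rewrite /dot trmx_mul trmxK mulmxA. Qed.

Lemma dot_col_mx m k (u u' : 'cV[R]_m) (v v' : 'cV[R]_k) :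
  dot (col_mx u v) (col_mx u' v') = dot u u' + dot v v'.
Proof. by rewrite /dot tr_col_mx mul_row_col mxE. Qed.

Lemma dotE m (u v : 'cV[R]_m) : dot u v = \sum_i u i 0 * v i 0.
Proof. by rewrite /dot mxE; apply: eq_bigr => i _; rewrite mxE. Qed.

Lemma dot_ge0 m (u : 'cV[R]_m) : 0 <= dot u u.
Proof. by rewrite dotE sumr_ge0 // => i _; rewrite -expr2 sqr_ge0. Qed.

Lemma dot_gt0 m (u : 'cV[R]_m) : (0 < dot u u) = (u != 0).
Proof.
rewrite lt0r dot_ge0 andbT; congr (~~ _); apply/eqP/eqP => [|->].
  rewrite dotE => /eqP; rewrite psumr_eq0 => [/allP u0|i _]; last first.
    by rewrite -expr2 sqr_ge0.
  apply/matrixP => i j; rewrite ord1 mxE; apply/eqP.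
  by have := u0 i (mem_index_enum i); rewrite /= mulf_eq0 orbb.
by rewrite dot0r.
Qed.

Lemma dot_cauchy m (u v : 'cV[R]_m) : dot u v ^+ 2 <= dot u u * dot v v.
Proof.
have [->|v0] := eqVneq v 0; first by rewrite !dot0r expr0n mulr0.
have vv : 0 < dot v v by rewrite dot_gt0.
have := dot_ge0 (dot v v *: u - dot u v *: v).
rewrite -scaleN1r !(dotDl, dotDr, dotZl, dotZr) (dotC v u).
set a := dot u u; set b := dot v v in vv *; set c := dot u v.
move=> h; rewrite -subr_ge0 -(pmulr_rge0 _ vv); apply: le_trans h _.
by rewrite le_eqVlt; apply/orP; left; apply/eqP; ring.
Qed.

Lemma quad_dot m (A : 'M[R]_m) (x : 'cV[R]_m) :
  (x^T *m A *m x) 0 0 = dot x (A *m x).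
Proof. by rewrite /dot mulmxA. Qed.

End Dot.

Lemma posdef_possemidef (R : realType) m (A : 'M[R]_m) :
  posdef A -> possemidef A.
Proof.
case=> sA pA; split=> // x; have [->|/pA/ltW //] := eqVneq x 0.
by rewrite mulmx0 mxE.
Qed.

Lemma loewner_le_refl (R : realType) m (A : 'M[R]_m) : A <=L A.
Proof.
rewrite /loewner_le subrr; split=> [|x]; last by rewrite mulmx0 mul0mx mxE.
by apply/symmetricmxP; rewrite trmx0.
Qed.

Lemma dot_subr (R : realType) m (A B : 'M[R]_m) x :
  (x^T *m (B - A) *m x) 0 0 = dot x (B *m x) - dot x (A *m x).
Proof. by rewrite quad_dot mulmxBl -scaleN1r dotDr dotZr mulN1r. Qed.

Lemma loewner_le_dot (R : realType) m (A B : 'M[R]_m) x : A <=L B ->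
  dot x (A *m x) <= dot x (B *m x).
Proof. by case=> _ /(_ x); rewrite dot_subr subr_ge0. Qed.

Lemma dot_loewner_le (R : realType) m (A B : 'M[R]_m) : A^T = A -> B^T = B ->
  (forall x, dot x (A *m x) <= dot x (B *m x)) -> A <=L B.
Proof.
move=> sA sB AB; split=> [|x]; last by rewrite dot_subr subr_ge0.
by apply/symmetricmxP; rewrite linearB /= sA sB.
Qed.

Lemma dot_block_mx (R : realType) m k (A : 'M[R]_m) (B : 'M[R]_(m, k))
    (D : 'M[R]_k) u v :
  dot (col_mx u v) (block_mx A B B^T D *m col_mx u v) =
  dot u (A *m u) + 2 * dot u (B *m v) + dot v (D *m v).
Proof.
rewrite mul_block_col dot_col_mx !dotDr (dot_mulmxr v) trmxK (dotC (B *m v)).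
ring.
Qed.

Lemma dot_rank_one (R : realType) m k (u y : 'cV[R]_m) (v w : 'cV[R]_k) :
  dot y (u *m v^T *m w) = dot y u * dot v w.
Proof. by rewrite /dot -mulmxA mulmxA mxE big_ord1. Qed.

Lemma const_mx1_neq0 (R : realType) k : (0 < k)%N ->
  (const_mx 1 : 'cV[R]_k) != 0.
Proof.
case: k => // k _; apply/eqP => /matrixP/(_ 0 0)/eqP.
by rewrite !mxE oner_eq0.
Qed.

(** * Square roots of positive semi-definite matrices *)

Lemma interpolation (F : fieldType) (s : seq F) (g : F -> F) :
  exists q : {poly F}, {in s, forall x, q.[x] = g x}.
Proof.
elim: s => [|x s [q qs]]; first by exists 0.
have [xs|xs] := boolP (x \in s).
  by exists q => y; rewrite inE => /predU1P[->|]; apply: qs.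
pose w : {poly F} := \prod_(y <- s) ('X - y%:P).
have wx : w.[x] != 0 by rewrite -[_ == 0]/(root w x) root_prod_XsubC.
exists (q + ((g x - q.[x]) / w.[x]) *: w) => y.
rewrite inE hornerD hornerZ => /predU1P[->|ys].
  by rewrite divfK // addrC subrK.
have /eqP -> : root w y by rewrite root_prod_XsubC.
by rewrite mulr0 addr0 qs.
Qed.

Lemma horner_mx_sym (R : comNzRingType) m (A : 'M[R]_m.+1) (q : {poly R}) :
  A^T = A -> (horner_mx A q)^T = horner_mx A q.
Proof.
move=> sA; elim/poly_ind: q => [|q c IH]; first by rewrite rmorph0 trmx0.
rewrite rmorphD rmorphM /= horner_mx_X horner_mx_C linearD /= tr_scalar_mx.
by rewrite trmx_mul IH sA; congr (_ + _); apply: comm_mx_horner.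
Qed.

(** Kept abstract in the field, so that applying it to the complex numbers
    never unfolds their arithmetic. *)
Lemma horner_mx_diagonalized (F : fieldType) m (A V : 'M[F]_m.+1)
    (d : 'rV_m.+1) (p : {poly F}) :
    V \in unitmx -> A = invmx V *m diag_mx d *m V ->
  (forall i, p.[d 0 i] = d 0 i) -> horner_mx A p = A.
Proof.
move=> uV -> pd; rewrite horner_mx_uconjC // horner_mx_diag.
by congr (_ *m diag_mx _ *m _); apply/rowP => i; rewrite mxE pd.
Qed.

(** The eigenvalues r i of A are nonnegative reals; a real polynomial q takes
    the value of their fourth root at each of them. Then Q = q(A) is symmetric
    and Q^4 = A, so Q^2 is a square root of A, and it is positive semi-definite
    because it equals Q'Q; this spares a computation of the spectrum of Q^2. *)
Lemma possemidef_sqrt_exists (R : realType) m (A : 'M[R]_m) :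
  possemidef A -> exists S : 'M[R]_m, possemidef S /\ S *m S = A.
Proof.
case: m A => [|m] A psA.
  by exists A; split=> //; apply/matrixP; case.
case: psA => /symmetricmxP sA psA.
pose f := [the {rmorphism R -> R[i]} of real_complex R].
pose AC := map_mx f A.
have AC_real : AC \is a mxOver Num.real.
  by apply/mxOverP => i j; rewrite mxE; apply/complex_realP; exists (A i j).
have AC_sym : AC \is symmetricmx.
  by apply/is_hermitianmxP; rewrite expr0 scale1r map_mx_id // /AC map_trmx sA.
have hAC := realsym_hermsym AC_sym AC_real.
have /mxOverP rd := hermitian_spectral_diag_real hAC.
have /orthomx_spectralP := hermitian_normalmx hAC.
set V := spectralmx AC; set d := spectral_diag AC => defAC.
have uV : V \in unitmx by apply: spectral_unit.
(* Hermitian matrices have a real spectrum, so r loses no information. *)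
pose r i := complex.Re (d 0 i).
have dE i : d 0 i = f (r i) by rewrite /f /= RRe_real.
have r_ge0 i : 0 <= r i.
  (* A real eigenvalue of AC is one of A, hence has a real eigenvector, on
     which the sign of the quadratic form of A can be read off. *)
  have : eigenvalue AC (f (r i)).
    apply/eigenvalueP; exists (row i V).
      rewrite [in LHS]defAC -!row_mul !mulmxA mulmxV // mul1mx -dE.
      by apply/rowP => j; rewrite mul_diag_mx !mxE.
    apply/eqP => Vi0; have /eqP := oner_neq0 R[i]; apply.
    move/(congr1 (fun M => row i M)): (mulmxV uV); rewrite row_mul Vi0 mul0mx.
    by move=> /rowP/(_ i); rewrite !mxE eqxx => /esym.
  rewrite eigenvalue_map => /eigenvalueP[v vA v0].
  have := psA v^T; rewrite trmxK vA -scalemxAl mxE => h.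
  rewrite -(pmulr_lge0 _ (_ : 0 < (v *m v^T) 0 0)) //.
  have := dot_gt0 v^T; rewrite /dot trmxK => ->.
  by apply: contraNneq v0 => /(congr1 trmx); rewrite trmxK trmx0 => ->.
have [q qE] := interpolation [seq r i | i : 'I_m.+1]
  (fun x => Num.sqrt (Num.sqrt x)).
have qr i : q.[r i] ^+ 2 ^+ 2 = r i.
  rewrite qE; last by rewrite map_f // mem_enum.
  by rewrite !sqr_sqrtr ?sqrtr_ge0.
have q4A : horner_mx A (q * q * (q * q)) = A.
  apply: (@map_mx_inj _ _ f); rewrite map_horner_mx -/AC.
  apply: (horner_mx_diagonalized uV defAC) => i.
  by rewrite dE horner_map !hornerM -!expr2 qr.
pose Q := horner_mx A q.
have sQ : Q^T = Q by apply: horner_mx_sym.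
exists (Q *m Q); split.
  split; first by apply/symmetricmxP; rewrite trmx_mul sQ.
  move=> x; have := dot_ge0 (Q *m x).
  by rewrite /dot trmx_mul sQ !mulmxA.
by rewrite -[RHS]q4A !rmorphM.
Qed.

Lemma sqrtmxP (R : realType) m (A : 'M[R]_m) : possemidef A ->
  (sqrtmx A)^T = sqrtmx A /\ sqrtmx A *m sqrtmx A = A.
Proof.
move=> /possemidef_sqrt_exists/(xgetPex 0)[[/symmetricmxP sS _] SS].
by split.
Qed.

(** * The S-lemma *)

(** The discriminant is positive and the product c / a of the roots is
    negative; that product is kept for the elimination in [cross_ineq]. *)
Lemma opposite_roots (R : rcfType) (a b c : R) : 0 < a -> c < 0 ->
  exists t1 t2, [/\ t1 < 0, 0 < t2, c + t1 * b + t1 ^+ 2 * a = 0,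
    c + t2 * b + t2 ^+ 2 * a = 0 & c = t1 * t2 * a].
Proof.
move=> a0 c0; pose r := Num.sqrt (b ^+ 2 - 4 * a * c).
have D0 : 0 < - (4 * a * c) by rewrite oppr_gt0 pmulr_rlt0 // mulr_gt0.
have r2 : r ^+ 2 = b ^+ 2 - 4 * a * c.
  by rewrite sqr_sqrtr // addr_ge0 ?sqr_ge0 // ltW.
have r0 : 0 <= r by apply: sqrtr_ge0.
have br : b < r by nra.
have nbr : - b < r by nra.
have a2 : 0 < (2 * a)^-1 by rewrite invr_gt0 mulr_gt0.
have an0 : a != 0 by rewrite gt_eqF.
have r2' : c = (b ^+ 2 - r ^+ 2) / (4 * a) by rewrite r2; field.
exists ((- b - r) / (2 * a)), ((- b + r) / (2 * a)); split.
- by rewrite pmulr_llt0 //; lra.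
- by rewrite pmulr_lgt0 //; lra.
- by rewrite r2'; field.
- by rewrite r2'; field.
- by rewrite r2'; field.
Qed.

Section SLemma.
Variables (R : realType) (m : nat).

Local Notation qf A x := (dot x (A *m x)).

Lemma quad_line (A : 'M[R]_m) x y t :
  qf A (x + t *: y) =
  qf A x + t * (dot x (A *m y) + dot y (A *m x)) + t ^+ 2 * qf A y.
Proof.
by rewrite mulmxDr -scalemxAr !(dotDl, dotDr, dotZl, dotZr); ring.
Qed.

(** On the line x + t y the form of B vanishes at some t1 < 0 < t2, where the
    form of A is thus nonnegative. In the combination of these two inequalities
    with positive weights t2 and - t1, the term linear in t cancels, leaving
    0 <= qf A x - t1 t2 qf A y, and t1 t2 = qf B x / qf B y. *)
Lemma cross_ineq (A B : 'M[R]_m) x y :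
  (forall x, qf B x = 0 -> 0 <= qf A x) -> qf B x < 0 -> 0 < qf B y ->
  qf B x * qf A y <= qf A x * qf B y.
Proof.
move=> AB Bx By.
have [t1 [t2 [t1_lt0 t2_gt0 e1 e2 Bxy]]] := opposite_roots
  (dot x (B *m y) + dot y (B *m x)) By Bx.
have /AB : qf B (x + t1 *: y) = 0 by rewrite quad_line.
have /AB : qf B (x + t2 *: y) = 0 by rewrite quad_line.
rewrite !quad_line; move: (qf A x) (qf A y) (dot x (A *m y) + _) => X Y b h2 h1.
have {h1 h2} h : 0 <= (t2 - t1) * (X - t1 * t2 * Y).
  have -> : (t2 - t1) * (X - t1 * t2 * Y) =
    t2 * (X + t1 * b + t1 ^+ 2 * Y) + - t1 * (X + t2 * b + t2 ^+ 2 * Y).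
    by ring.
  by apply: addr_ge0; apply: mulr_ge0; rewrite ?oppr_ge0 // ltW.
move: h; rewrite pmulr_rge0; last by rewrite subr_gt0; lra.
rewrite subr_ge0 Bxy => h.
by rewrite mulrAC ler_pM2r.
Qed.

(** The number a must lie above all the quotients qf A x / qf B x with
    qf B x < 0 and below all those with qf B x > 0. [cross_ineq] says that the
    former are below the latter, so their supremum will do; x0 and y0 make it
    a supremum of a nonempty bounded set. *)
Lemma s_lemma (A B : 'M[R]_m) x0 y0 :
  qf B x0 < 0 -> 0 < qf B y0 ->
  (forall x, qf B x = 0 -> 0 <= qf A x) ->
  exists a, forall x, a * qf B x <= qf A x.
Proof.
move=> Bx0 By0 AB.
pose E := [set c | exists2 x, qf B x < 0 & c = qf A x / qf B x]%classic.
have Eub y : 0 < qf B y -> ubound E (qf A y / qf B y).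
  move=> By _ [x Bx ->]; rewrite ler_pdivlMr // mulrAC ler_ndivrMr //.
  rewrite mulrC; exact: cross_ineq.
have E0 : (E !=set0)%classic by exists (qf A x0 / qf B x0), x0.
exists (sup E) => x; have [Bx|Bx|Bx] := ltgtP (qf B x) 0.
- rewrite -ler_ndivrMr //; apply: ub_le_sup; last by exists x.
  by exists (qf A y0 / qf B y0); apply: Eub.
- by rewrite -ler_pdivlMr //; apply: ge_sup => //; apply: Eub.
- by rewrite Bx mulr0; apply: AB.
Qed.

End SLemma.

(** * Inequalities between scalars *)

Lemma affine_lower_bound (R : realFieldType) (b c : R) :
  (forall s, 0 <= b + s * c) -> c = 0.
Proof.
move=> h; apply/eqP; apply: contraT => c0.
have := h (- (b + 1) / c); rewrite divfK //; lra.
Qed.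

(** The arithmetic content of the implication from feasible to conservative,
    for a fixed x: ci and qi are the values of the covariance bound and of the
    actual covariance block at Ki'x, q12 is the cross term and X = x'Px. Only
    multiples of K1'x and K2'x are needed as test vectors. *)
Lemma scalar_bound (R : realFieldType) (a X c1 c2 q1 q2 q12 : R) :
  0 <= a <= 1 -> q1 <= c1 -> q2 <= c2 ->
  (forall s t, 0 <= X + 2 * s * c1 + a * s ^+ 2 * c1
       + 2 * t * c2 + (1 - a) * t ^+ 2 * c2) ->
  (forall s t, 0 <= s ^+ 2 * q1 + 2 * s * t * q12 + t ^+ 2 * q2) ->
  q1 + 2 * q12 + q2 <= X.
Proof.
move=> /andP[a0 a1] le1 le2 scal joint.
have q1_ge0 : 0 <= q1 by have := joint 1 0; lra.
have q2_ge0 : 0 <= q2 by have := joint 0 1; lra.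
have cross0 : q1 = 0 \/ q2 = 0 -> q12 = 0.
  case=> e; apply: (@affine_lower_bound _ (q1 + q2)) => s.
    have := joint (s / 2) 1; rewrite e; lra.
  have := joint 1 (s / 2); rewrite e; lra.
have [a_eq0|a_neq0] := eqVneq a 0.
  have c1_eq0 : c1 = 0.
    apply: (@affine_lower_bound _ X) => s.
    have := scal (s / 2) 0; rewrite a_eq0; lra.
  have q1_eq0 : q1 = 0 by lra.
  rewrite (cross0 (or_introl q1_eq0)).
  have := scal 0 (-1); rewrite a_eq0; lra.
have [a_eq1|a_neq1] := eqVneq a 1.
  have c2_eq0 : c2 = 0.
    apply: (@affine_lower_bound _ X) => s.
    have := scal 0 (s / 2); rewrite a_eq1; lra.
  have q2_eq0 : q2 = 0 by lra.
  rewrite (cross0 (or_intror q2_eq0)).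
  have := scal (-1) 0; rewrite a_eq1; lra.
have a_gt0 : 0 < a by rewrite lt0r a_neq0.
have b_gt0 : 0 < 1 - a by rewrite subr_gt0 lt_neqAle a_neq1.
have ab_gt0 : 0 < a * (1 - a) by rewrite mulr_gt0.
(* The choice s = - 1/a, t = - 1/(1 - a) minimizes the form in scal. *)
have X_ge : (1 - a) * c1 + a * c2 <= a * (1 - a) * X.
  have := scal (- a^-1) (- (1 - a)^-1).
  rewrite -(pmulr_rge0 _ ab_gt0) => h; rewrite -subr_ge0.
  apply: le_trans h _; rewrite le_eqVlt; apply/orP; left; apply/eqP.
  by field; rewrite a_neq0 gt_eqF.
rewrite -(ler_pM2l ab_gt0).
(* These weights bound 2 a (1 - a) q12; adding a (1 - a) (q1 + q2) to the bound
   gives (1 - a) q1 + a q2, whose coefficients are those of X_ge. *)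
have := joint (1 - a) (- a).
nra.
Qed.

(** Used to reach a semi-definite worst-case joint covariance through positive
    definite ones. *)
Lemma le_of_scaled (R : realFieldType) (b c X : R) :
  (forall t, 0 <= t -> t < 1 -> b + t * c <= X) -> b + c <= X.
Proof.
move=> h; have b_le : b <= X by have := h 0 (lexx _) ltr01; rewrite mul0r addr0.
rewrite leNgt; apply/negP => bc.
have c0 : 0 < c by lra.
have t0 : 0 <= ((X - b) / c + 1) / 2.
  by rewrite divr_ge0 // addr_ge0 // divr_ge0 ?subr_ge0 // ltW.
have t1 : ((X - b) / c + 1) / 2 < 1.
  rewrite ltr_pdivrMr // mul1r -ltrBrDr (_ : 2 - 1 = 1); last by ring.
  by rewrite ltr_pdivrMr // mul1r; lra.
have := h _ t0 t1.
have -> : ((X - b) / c + 1) / 2 * c = (X - b + c) / 2.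
  by field; rewrite gt_eqF.
lra.
Qed.

(** * From feasible to conservative *)

Section Pointwise.
Variables (R : realType) (n p1 p2 : nat) (z : fusion_input R p1 p2).
Variables (K1 : 'M[R]_(n, p1)) (K2 : 'M[R]_(n, p2)) (P : 'M[R]_n).

Local Notation S1 := (sqrtmx (cov1 z)).
Local Notation S2 := (sqrtmx (cov2 z)).
Local Notation y1 x := (K1^T *m x).
Local Notation y2 x := (K2^T *m x).
Local Notation K := (row_mx K1 K2).

(** Stated at a single z: preserving conservativeness constrains the values of
    a rule at each point separately. *)
Definition conservative : Prop :=
  forall (P1 : 'M[R]_p1) (P12 : 'M[R]_(p1, p2)) (P2 : 'M[R]_p2),
    let Pjoint := block_mx P1 P12 P12^T P2 in
    posdef Pjoint -> P1 <=L cov1 z -> P2 <=L cov2 z ->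
    K *m Pjoint *m K^T <=L P.

Let S1s : S1^T = S1.
Proof. by case: (sqrtmxP (posdef_possemidef (cov1_posdef z))). Qed.

Let S2s : S2^T = S2.
Proof. by case: (sqrtmxP (posdef_possemidef (cov2_posdef z))). Qed.

Let S1K u : dot (S1 *m u) (S1 *m u) = dot u (cov1 z *m u).
Proof.
case: (sqrtmxP (posdef_possemidef (cov1_posdef z))) => _ {3}<-.
by rewrite -mulmxA [in RHS]dot_mulmxr S1s.
Qed.

Let S2K u : dot (S2 *m u) (S2 *m u) = dot u (cov2 z *m u).
Proof.
case: (sqrtmxP (posdef_possemidef (cov2_posdef z))) => _ {3}<-.
by rewrite -mulmxA [in RHS]dot_mulmxr S2s.
Qed.

Let cov1_gt0 u : u != 0 -> 0 < dot u (cov1 z *m u).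
Proof. by case: (cov1_posdef z) => _ h /h; rewrite quad_dot. Qed.

Let cov2_gt0 u : u != 0 -> 0 < dot u (cov2 z *m u).
Proof. by case: (cov2_posdef z) => _ h /h; rewrite quad_dot. Qed.

Let cov1s : (cov1 z)^T = cov1 z.
Proof. by case: (cov1_posdef z) => /symmetricmxP. Qed.

Let cov2s : (cov2 z)^T = cov2 z.
Proof. by case: (cov2_posdef z) => /symmetricmxP. Qed.

Lemma SDP_quad a x u v :
  let w := col_mx x (col_mx u v) in
  dot w (SDP_matrix z a K1 K2 P *m w) =
  dot x (P *m x) + 2 * dot (S1 *m y1 x) u + 2 * dot (S2 *m y2 x) v
  + a * dot u u + (1 - a) * dot v v.
Proof.
have trK : col_mx (S1 *m K1^T) (S2 *m K2^T) =
    (row_mx (K1 *m S1) (K2 *m S2))^T.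
  by rewrite tr_row_mx !trmx_mul S1s S2s.
rewrite /SDP_matrix /= trK dot_block_mx -(trmx0 R p1 p2).
rewrite dot_block_mx mul0mx dot0r mul_row_col.
rewrite dotDr !mul_scalar_mx !dotZr !dot_mulmxr !trmx_mul S1s S2s !mulmxA.
ring.
Qed.

Lemma SDP_matrix_sym a : P^T = P ->
  (SDP_matrix z a K1 K2 P)^T = SDP_matrix z a K1 K2 P.
Proof.
move=> sP; rewrite /SDP_matrix /= !(tr_block_mx, tr_row_mx, tr_col_mx).
by rewrite !trmx_mul !trmxK S1s S2s !tr_scalar_mx !trmx0 sP.
Qed.

Lemma joint_quad P1 P12 P2 x :
  dot x (K *m block_mx P1 P12 P12^T P2 *m K^T *m x) =
  dot (y1 x) (P1 *m y1 x) + 2 * dot (y1 x) (P12 *m y2 x)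
  + dot (y2 x) (P2 *m y2 x).
Proof.
rewrite -!mulmxA dot_mulmxr -dot_block_mx tr_row_mx.
by rewrite -mul_col_mx.
Qed.

Lemma SDP_bounds a : (0 < p1)%N -> (0 < p2)%N ->
  possemidef (SDP_matrix z a K1 K2 P) -> 0 <= a <= 1.
Proof.
move=> p1_gt0 p2_gt0 [_ psd].
have := psd (col_mx 0 (col_mx (const_mx 1) 0)).
have := psd (col_mx 0 (col_mx 0 (const_mx 1))).
rewrite !quad_dot !SDP_quad !mulmx0 !(dotC 0) !dot0r !mulr0 !add0r addr0.
by rewrite !pmulr_lge0 ?dot_gt0 ?const_mx1_neq0 // subr_ge0 => -> ->.
Qed.

(** Test vectors u and v proportional to the vectors they are paired with. *)
Lemma SDP_scaling a x s t : possemidef (SDP_matrix z a K1 K2 P) ->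
  let c1 := dot (y1 x) (cov1 z *m y1 x) in
  let c2 := dot (y2 x) (cov2 z *m y2 x) in
  0 <= dot x (P *m x) + 2 * s * c1 + a * s ^+ 2 * c1
       + 2 * t * c2 + (1 - a) * t ^+ 2 * c2.
Proof.
case=> _ psd /=.
have := psd (col_mx x (col_mx (s *: (S1 *m y1 x)) (t *: (S2 *m y2 x)))).
rewrite quad_dot SDP_quad !(dotZr, dotZl) S1K S2K => h.
by apply: le_trans h _; rewrite le_eqVlt; apply/orP; left; apply/eqP; ring.
Qed.

(** The program only asks for P to be positive semi-definite, but taking
    s = t = -1 in [SDP_scaling] gives x'Px >= c1 + c2, and unbiasedness makes
    one of K1'x, K2'x nonzero when x is. *)
Lemma SDP_posdef (H1 : 'M[R]_(p1, n)) (H2 : 'M[R]_(p2, n)) a :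
  (0 < p1)%N -> (0 < p2)%N -> SDP_feasible H1 H2 z a K1 K2 P -> posdef P.
Proof.
move=> p1_gt0 p2_gt0 [[sP psP] psd unb]; split=> // x x0.
have /andP[a0 a1] := SDP_bounds p1_gt0 p2_gt0 psd.
have := SDP_scaling x (-1) (-1) psd; rewrite /= quad_dot.
have c1 : 0 <= dot (y1 x) (cov1 z *m y1 x) by rewrite -S1K dot_ge0.
have c2 : 0 <= dot (y2 x) (cov2 z *m y2 x) by rewrite -S2K dot_ge0.
have : 0 < dot (y1 x) (cov1 z *m y1 x) + dot (y2 x) (cov2 z *m y2 x).
  have [y10|/cov1_gt0 ?] := eqVneq (y1 x) 0; last by rewrite ltr_wpDr.
  rewrite y10 ltr_wpDl ?mulmx0 ?dot0r // cov2_gt0 //.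
  apply: contraNneq x0 => y20; rewrite -[x]mul1mx -[1%:M]trmx1 -unb.
  by rewrite linearD /= !trmx_mul mulmxDl -!mulmxA y10 y20 !mulmx0 addr0.
move: c1 c2; move: (dot _ _) (dot (y1 x) _) (dot (y2 x) _) => X c1 c2.
nra.
Qed.

Lemma SDP_conservative a : (0 < p1)%N -> (0 < p2)%N -> possemidef P ->
  possemidef (SDP_matrix z a K1 K2 P) -> conservative.
Proof.
move=> p1_gt0 p2_gt0 [/symmetricmxP sP _] psd P1 P12 P2 Pj pdj le1 le2.
have /andP[a0 a1] := SDP_bounds p1_gt0 p2_gt0 psd.
have sPj : Pj^T = Pj by case: pdj => /symmetricmxP.
apply: dot_loewner_le => // [|x]; first by rewrite !trmx_mul trmxK sPj !mulmxA.
rewrite joint_quad.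
have /= scal := fun s t => SDP_scaling x s t psd.
have {}le1 := loewner_le_dot (y1 x) le1.
have {}le2 := loewner_le_dot (y2 x) le2.
have joint s t : 0 <= s ^+ 2 * dot (y1 x) (P1 *m y1 x)
    + 2 * s * t * dot (y1 x) (P12 *m y2 x)
    + t ^+ 2 * dot (y2 x) (P2 *m y2 x).
  case: (posdef_possemidef pdj) => _.
  move=> /(_ (col_mx (s *: y1 x) (t *: y2 x))).
  rewrite quad_dot dot_block_mx -!scalemxAr !(dotZl, dotZr) => h.
  by apply: le_trans h _; rewrite le_eqVlt; apply/orP; left; apply/eqP; ring.
by apply: (scalar_bound _ le1 le2 scal joint); rewrite a0.
Qed.

(** * From conservative to feasible *)

(** S1 u v' S2 is the cross-covariance whose correlation is fully concentrated
    on the pair of directions u, v. *)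
Lemma dot_worst_case c u v w1 w2 :
  dot w1 (c *: (S1 *m (u *m v^T) *m S2) *m w2) =
  c * (dot (S1 *m w1) u * dot (S2 *m w2) v).
Proof.
rewrite -scalemxAl dotZr -(mulmxA _ S2) -(mulmxA S1) dot_mulmxr S1s.
by rewrite dot_rank_one (dotC v).
Qed.

(** By Cauchy-Schwarz the rank one matrix u v' / T has norm 1, so a factor
    t < 1 makes the diagonal blocks strictly dominate the cross-covariance. *)
Lemma worst_case_posdef T t u v : 0 < T -> dot u u = T -> dot v v = T ->
    0 <= t -> t < 1 ->
  let P12 := (t / T) *: (S1 *m (u *m v^T) *m S2) in
  posdef (block_mx (cov1 z) P12 P12^T (cov2 z)).
Proof.
move=> T0 uT vT t0 t1 P12; split=> [|w].
  by apply/symmetricmxP; rewrite tr_block_mx trmxK cov1s cov2s.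
rewrite -[w]vsubmxK col_mx_eq0 quad_dot dot_block_mx; set w1 := usubmx w.
set w2 := dsubmx w => w_neq0.
have -> : dot w1 (P12 *m w2) = t / T * (dot (S1 *m w1) u * dot (S2 *m w2) v).
  exact: dot_worst_case.
have := dot_cauchy (S1 *m w1) u; have := dot_cauchy (S2 *m w2) v.
rewrite uT vT S1K S2K.
have : 0 < dot w1 (cov1 z *m w1) + dot w2 (cov2 z *m w2).
  have w1_ge0 : 0 <= dot w1 (cov1 z *m w1) by rewrite -S1K dot_ge0.
  have w2_ge0 : 0 <= dot w2 (cov2 z *m w2) by rewrite -S2K dot_ge0.
  move: w_neq0; rewrite negb_and => /orP[/cov1_gt0|/cov2_gt0] ?.
    by rewrite ltr_wpDr.
  by rewrite ltr_wpDl.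
move: (dot w1 _) (dot w2 _) (dot _ u) (dot _ v) => q1 q2 p r q_gt0 rT pT.
have Tn0 : T != 0 by rewrite gt_eqF.
rewrite -(pmulr_rgt0 _ T0).
have -> : T * (q1 + 2 * (t / T * (p * r)) + q2) =
  T * (q1 + q2) + t * (2 * (p * r)) by field.
have pr : - (T * (q1 + q2)) <= 2 * (p * r).
  by have := sqr_ge0 (p + r); lra.
have Tq : 0 < T * (q1 + q2) by rewrite mulr_gt0.
nra.
Qed.

Lemma conservative_bound T x u v : 0 < T -> dot u u = T -> dot v v = T ->
  conservative ->
  dot (S1 *m y1 x) (S1 *m y1 x) + dot (S2 *m y2 x) (S2 *m y2 x)
  + 2 * (dot (S1 *m y1 x) u * dot (S2 *m y2 x) v) / T <= dot x (P *m x).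
Proof.
move=> T0 uT vT cons; apply: le_of_scaled => t t0 t1.
have := cons _ _ _ (worst_case_posdef T0 uT vT t0 t1)
  (loewner_le_refl _) (loewner_le_refl _).
move=> /(loewner_le_dot x); rewrite joint_quad -S1K -S2K.
rewrite dot_worst_case => h.
by apply: le_trans _ h; rewrite le_eqVlt; apply/orP; left; apply/eqP; ring.
Qed.

(** The S-lemma for the forms q0 (the SDP matrix for a = 0) and
    q1 = |v|^2 - |u|^2. When |u|^2 = |v|^2 = T > 0, put p = (S1 K1'x)'u and
    r = (S2 K2'x)'v. Cauchy-Schwarz turns [conservative_bound] into
    (p + r)^2 <= T x'Px, so T q0 >= (p + r)^2 + 2 T (p + r) + T^2, a square. *)
Lemma conservative_SDP : (0 < p1)%N -> (0 < p2)%N -> possemidef P ->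
  conservative -> exists a, possemidef (SDP_matrix z a K1 K2 P).
Proof.
move=> p1_gt0 p2_gt0 [/symmetricmxP sP psP] cons.
pose B : 'M[R]_(n + (p1 + p2)) := block_mx 0 0 0 (block_mx (- 1)%:M 0 0 1%:M).
have quadB x u v : let w := col_mx x (col_mx u v) in
    dot w (B *m w) = dot v v - dot u u.
  rewrite /B /= !mul_block_col !mul0mx !add0r !addr0 !mul_scalar_mx.
  by rewrite !dot_col_mx dot0r !dotZr add0r mul1r mulN1r addrC.
have [||w|a aP] := @s_lemma R _ (SDP_matrix z 0 K1 K2 P) B
  (col_mx 0 (col_mx (const_mx 1) 0)) (col_mx 0 (col_mx 0 (const_mx 1))).
- by rewrite quadB dot0r sub0r oppr_lt0 dot_gt0 const_mx1_neq0.
- by rewrite quadB dot0r subr0 dot_gt0 const_mx1_neq0.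
- rewrite -[w]vsubmxK -[dsubmx w]vsubmxK.
  move: (usubmx w) (usubmx (dsubmx w)) (dsubmx (dsubmx w)) => x u v.
  rewrite quadB SDP_quad => /eqP; rewrite subr_eq0 => /eqP uv.
  rewrite mul0r addr0 subr0 mul1r.
  have [v0|v0] := eqVneq v 0.
    have u0 : u = 0.
      by apply/eqP; rewrite -[_ == _]negbK -dot_gt0 -uv v0 dot0r ltxx.
    by rewrite u0 v0 !dot0r !mulr0 !addr0 -quad_dot.
  have T0 : 0 < dot v v by rewrite dot_gt0.
  have := conservative_bound x T0 (esym uv) erefl cons.
  have := dot_cauchy (S1 *m y1 x) u; have := dot_cauchy (S2 *m y2 x) v.
  rewrite -uv; move: T0; set T := dot v v; set X := dot x _.
  set p := dot _ u; set r := dot _ v; set q1 := dot (S1 *m _) _.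
  set q2 := dot (S2 *m _) _ => T0 rT pT X_ge.
  have TX : T * (q1 + q2) + 2 * (p * r) <= T * X.
    rewrite -(ler_pM2l T0) in X_ge; apply: le_trans X_ge.
    rewrite le_eqVlt; apply/orP; left; apply/eqP; field.
    by rewrite gt_eqF.
  rewrite -(pmulr_rge0 _ T0).
  have := sqr_ge0 (p + r + T); nra.
exists a; split=> [|w].
  by apply/symmetricmxP; apply: SDP_matrix_sym.
have := aP w; rewrite quad_dot -[w]vsubmxK -[dsubmx w]vsubmxK quadB !SDP_quad.
lra.
Qed.

End Pointwise.

(** * Equivalence of the two problems *)

Lemma fusion_rule_SDP (R : realType) (n p1 p2 : nat)
    (H1 : 'M[R]_(p1, n)) (H2 : 'M[R]_(p2, n)) (z : fusion_input R p1 p2)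
    (K1 : 'M[R]_(n, p1)) (K2 : 'M[R]_(n, p2)) (P : 'M[R]_n) :
    (0 < p1)%N -> (0 < p2)%N ->
  [/\ posdef P, unbiased_gains H1 H2 K1 K2 & conservative z K1 K2 P] <->
  exists a, SDP_feasible H1 H2 z a K1 K2 P.
Proof.
move=> p1_gt0 p2_gt0; split=> [[/posdef_possemidef psP unb cons]|[a feas]].
  by have [a aP] := conservative_SDP p1_gt0 p2_gt0 psP cons; exists a; split.
split; first exact: SDP_posdef feas.
  by case: feas.
by case: feas => psP aP _; apply: SDP_conservative aP.
Qed.

(** Lets a pointwise competitor be inserted in a global rule. *)
Lemma fusion_rule_pointwise (R : realType) (n p1 p2 : nat)
    (H1 : 'M[R]_(p1, n)) (H2 : 'M[R]_(p2, n))
    (K1 : fusion_input R p1 p2 -> 'M[R]_(n, p1))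
    (K2 : fusion_input R p1 p2 -> 'M[R]_(n, p2))
    (P : fusion_input R p1 p2 -> 'M[R]_n) :
  (0 < p1)%N -> (0 < p2)%N ->
  fusion_rule H1 H2 K1 K2 P <->
  forall z, exists a, SDP_feasible H1 H2 z a (K1 z) (K2 z) (P z).
Proof.
move=> p1_gt0 p2_gt0; split=> [[pP unb cons] z|feas].
  by apply/fusion_rule_SDP => //; split=> //; apply: cons.
by split=> z; have /fusion_rule_SDP[] := feas z.
Qed.

Theorem theorem27 (R : realType) (n p1 p2 : nat)
    (n_gt0 : (0 < n)%N) (p1_gt0 : (0 < p1)%N) (p2_gt0 : (0 < p2)%N)
    (le_p1n : (p1 <= n)%N) (le_p2n : (p2 <= n)%N)
    (H1 : 'M[R]_(p1, n)) (H2 : 'M[R]_(p2, n))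
    (rkH1 : \rank H1 = p1) (rkH2 : \rank H2 = p2)
    (rkH : \rank (col_mx H1 H2) = n)
    (J : 'M[R]_n -> R) (J_isotone : strictly_isotone J)
    (K1 : fusion_input R p1 p2 -> 'M[R]_(n, p1))
    (K2 : fusion_input R p1 p2 -> 'M[R]_(n, p2))
    (P : fusion_input R p1 p2 -> 'M[R]_n) :
  OF_solution H1 H2 J K1 K2 P <->
  exists a : fusion_input R p1 p2 -> R, SDP_solution H1 H2 J a K1 K2 P.
Proof.
have ruleP := fusion_rule_pointwise H1 H2 _ _ _ p1_gt0 p2_gt0.
split=> [[/ruleP feas opt]|[a sol]]; last first.
  split=> [|L1 L2 Q /ruleP feas z]; first apply/ruleP => z.
    by exists (a z); case: (sol z).
  by have [b /(proj2 (sol z))] := feas z.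
have [a aP] := choice feas.
(* A competitor at z becomes a fusion rule by keeping K1, K2, P elsewhere. *)
exists a => z; split=> // b L1 L2 Q Qfeas.
pose at_z T (g : fusion_input R p1 p2 -> T) (c : T) z' :=
  if pselect (z' = z) then c else g z'.
have at_zE T (g : fusion_input R p1 p2 -> T) c : at_z T g c z = c.
  by rewrite /at_z; case: pselect.
rewrite -[Q](at_zE _ P); apply: (opt (at_z _ K1 L1) (at_z _ K2 L2)).
apply/ruleP => z'; rewrite /at_z; case: pselect => [e|_] /=; last exact: feas.
by rewrite e; exists b.
Qed.
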